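(* Let $t_0, r\in\mathbb{R}$ with $r>0$ and let $I:=[t_0,t_0+r]$. Suppose that $f:I\times\mathbb{R}\to\mathbb{R}$ is a continuous function satisfying the Lipschitz condition $$|f(t,y_1)-f(t,y_2)|\leq L|y_1-y_2|$$ for all $t\in I$, all $y_1,y_2\in\mathbb{R}$ and some $L>0$. Let $\varphi:I\to(0,\infty)$ be a nondecreasing continuous function, and let $\eta$ be an arbitrary fixed real number with $\eta>L$. If a continuous function $y:I\to\mathbb{R}$ satisfies $$\left|y(t)-\int_{t_0}^{t}f(s,y(s))\,ds\right|\leq\varphi(t)$$ for all $t\in I$, then there exists a unique solution $y_0:I\to\mathbb{R}$ of the Volterra integral equation $$y_0(t)=\int_{t_0}^{t}f(s,y_0(s))\,ds,\qquad t\in I,$$ satisfying $$|y(t)-y_0(t)|\leq\frac{\varphi(t)\,e^{\eta r}}{1-L/\eta}$$ for all $t\in I$.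
   Context: A solution of the Volterra integral equation on $I$ is a continuous function $y_0:I\to\mathbb{R}$ satisfying the equation for every $t\in I$. *)

(* Defs.v *)
From Stdlib Require Import Reals.
From Coquelicot Require Import Coquelicot.
Open Scope R_scope.

(* Functions on the interval are total functions R -> R whose values outside
   [a, b] are irrelevant: continuity is relative to [a, b] (one-sided at the
   endpoints), and equations are only required on [a, b]. *)
Definition Icc (a b : R) (t : R) : Prop := a <= t <= b.

Definition volterra_solution (t0 r : R) (f : R -> R -> R) (y0 : R -> R) : Prop :=
  continuous_on (Icc t0 (t0 + r)) y0 /\
  forall t, Icc t0 (t0 + r) t -> y0 t = RInt (fun s => f s (y0 s)) t0 t.

(* Main.v *)
(** Weigh differences of functions on [t0, t0 + r] by [exp (eta * (t - t0))]:
    the operator [u |-> (t |-> RInt (fun s => f s (u s)) t0 t)] is then a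
    contraction of ratio [q = L / eta < 1]. Since [phi] is nondecreasing, at a
    given [t] the factor [phi s], [s <= t], may be frozen to [phi t], so the Picard
    iterates starting from [y] have successive distances at most
    [phi t * exp (eta * (t - t0)) * q ^ n]; summing the geometric series gives the
    bound. Two solutions near [y] are at bounded distance, which the
    contraction forces to be zero. *)

Require Import Defs.
From Stdlib Require Import Reals Lra.
From Coquelicot Require Import Coquelicot.
Open Scope R_scope.

(** * Continuity and integration relative to a compact interval *)

Lemma exp_monotone (x y : R) : x <= y -> exp x <= exp y.
Proof.
  intros [h| ->]; [left; apply exp_increasing, h|apply Rle_refl].
Qed.

(** Composing [g] with the clamp onto [[a, b]] extends it by its endpoint values. This turns
    one-sided continuity at the endpoints into ordinary continuity, for which integrability and
    differentiation of the integral are available. *)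
Lemma continuous_on_extend (a b : R) (g : R -> R) :
  a <= b -> continuous_on (Icc a b) g ->
  exists h : R -> R, (forall x, continuous h x) /\
                     (forall x, Icc a b x -> h x = g x).
Proof.
  intros hab hg.
  set (c := fun x => Rmax a (Rmin b x)).
  assert (hc : forall x, Icc a b (c x)).
  { intros x; unfold c, Icc, Rmax, Rmin.
    repeat destruct Rle_dec; lra. }
  exists (fun x => g (c x)); split.
  - intros x; unfold continuous.
    apply (filterlim_comp _ _ _ c g _ (within (Icc a b) (locally (c x)))).
    (* The clamp is 1-Lipschitz, so the same [eps] serves for its argument. *)
    + intros P [eps HP]; exists eps; intros z Hz.
      apply HP; [|apply hc].
      unfold ball in *; simpl in *; unfold AbsRing_ball, abs, minus, plus, opp in *.
      simpl in *.
      apply Rle_lt_trans with (2 := Hz).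
      unfold c, Rmax, Rmin, Rabs.
      repeat destruct Rle_dec; repeat destruct Rcase_abs; lra.
    + apply hg, hc.
  - intros x [h1 h2]; unfold c.
    rewrite Rmin_right, Rmax_right; lra.
Qed.

Lemma ex_RInt_continuous_on (a b : R) (g : R -> R) (t : R) :
  continuous_on (Icc a b) g -> Icc a b t -> ex_RInt g a t.
Proof.
  intros hg [h1 h2].
  destruct (continuous_on_extend a b g) as [h [hc he]]; [lra|assumption|].
  apply ex_RInt_ext with h.
  - intros x hx; rewrite Rmin_left, Rmax_right in hx by lra.
    apply he; unfold Icc; lra.
  - apply (ex_RInt_continuous (V := R_CompleteNormedModule)); auto.
Qed.

Lemma continuous_on_RInt (a b : R) (g : R -> R) :
  continuous_on (Icc a b) g -> continuous_on (Icc a b) (fun t => RInt g a t).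
Proof.
  intros hg t [h1 h2].
  destruct (continuous_on_extend a b g) as [h [hc he]]; [lra|assumption|].
  assert (heq : forall s, Icc a b s -> RInt h a s = RInt g a s).
  { intros s [h3 h4]; apply RInt_ext; intros x hx.
    rewrite Rmin_left, Rmax_right in hx by lra.
    apply he; unfold Icc; lra. }
  rewrite <- (heq t) by (split; assumption).
  apply (filterlim_within_ext _ (fun s => RInt h a s) _ heq).
  refine (@filterlim_filter_le_1 _ _ (locally t) _ _ _ _ _).
  - apply filter_le_within.
  - apply (ex_derive_continuous (V := R_NormedModule) (fun s => RInt h a s)).
    exists (h t).
    apply (is_derive_RInt h _ a); [|apply hc].
    exists (mkposreal 1 Rlt_0_1); intros s _.
    apply (RInt_correct (V := R_CompleteNormedModule)).
    apply (ex_RInt_continuous (V := R_CompleteNormedModule)); auto.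
Qed.

(** The graph map [s |-> (s, u s)] sends [D] into the strip over [D], so relative continuity
    composes. *)
Lemma continuous_on_curve (D : R -> Prop) (f : R -> R -> R) (u : R -> R) :
  continuous_on (fun p : R * R => D (fst p)) (fun p : R * R => f (fst p) (snd p)) ->
  continuous_on D u -> continuous_on D (fun s => f s (u s)).
Proof.
  intros hf hu x hx.
  apply (filterlim_comp _ _ _ (fun s => (s, u s)) (fun p : R * R => f (fst p) (snd p))
           _ (within (fun p : R * R => D (fst p)) (locally (x, u x)))).
  - intros P [eps HP].
    specialize (hu x hx (ball (u x) eps) (locally_ball _ eps)).
    unfold filtermap, within in *.
    generalize (filter_and _ _ hu (locally_ball x eps)).
    apply filter_imp; intros s [h1 h2] hs.
    apply HP; [split; simpl; auto|exact hs].
  - exact (hf (x, u x) hx).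
Qed.

Lemma continuous_on_uniform_limit (D : R -> Prop) (u : nat -> R -> R) (v : R -> R)
    (e : nat -> R) :
  (forall n, continuous_on D (u n)) -> is_lim_seq e 0 ->
  (forall n t, D t -> Rabs (u n t - v t) <= e n) -> continuous_on D v.
Proof.
  intros hu he huv x hx.
  apply filterlim_locally; intros eps.
  (* One third each for the distances [v s] to [u N s], [u N s] to [u N x], and [u N x] to [v x]. *)
  assert (h3 : 0 < eps / 3) by (generalize (cond_pos eps); lra).
  apply is_lim_seq_spec in he.
  destruct (he (mkposreal _ h3)) as [N hN]; specialize (hN N (le_n N)); simpl in hN.
  rewrite Rminus_0_r in hN; apply Rabs_def2 in hN.
  generalize (hu N x hx (ball (u N x) (mkposreal _ h3)) (locally_ball _ _)).
  unfold filtermap, within; apply filter_imp; intros s hs ds.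
  specialize (hs ds).
  generalize (huv N s ds) (huv N x hx); intros k1 k2.
  unfold ball in *; simpl in *; unfold AbsRing_ball, abs, minus, plus, opp in *.
  simpl in *.
  apply Rabs_def2 in hs.
  apply Rabs_le_between in k1; apply Rabs_le_between in k2.
  apply Rabs_def1; lra.
Qed.

(** * Sequences controlled by a geometric rate *)

Lemma is_lim_seq_scal_geom (q : R) :
  0 <= q < 1 -> forall K, is_lim_seq (fun n => K * q ^ n) 0.
Proof.
  intros hq K.
  replace (Finite 0) with (Rbar_mult K 0) by (simpl; f_equal; ring).
  apply is_lim_seq_scal_l, is_lim_seq_geom.
  rewrite Rabs_pos_eq; lra.
Qed.

(* With [a n = K / (1 - q) * q ^ n] one has [a n - a (S n) = K * q ^ n], so
   [u - a] increases and [u + a] decreases. *)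
Lemma geometric_cauchy_bound (u : nat -> R) (K q : R) :
  0 <= q < 1 -> (forall n, Rabs (u (S n) - u n) <= K * q ^ n) ->
  forall n, Rabs (u n - Lim_seq u) <= K / (1 - q) * q ^ n.
Proof.
  intros hq hu.
  set (a := fun n => K / (1 - q) * q ^ n).
  assert (ha : is_lim_seq a 0) by (apply is_lim_seq_scal_geom; exact hq).
  assert (hstep : forall n, a n - a (S n) = K * q ^ n).
  { intros n; unfold a; simpl; field; lra. }
  assert (hincr : forall n, u n - a n <= u (S n) - a (S n)).
  { intros n; specialize (hu n); specialize (hstep n).
    apply Rabs_le_between in hu; lra. }
  assert (hdecr : forall n, u (S n) + a (S n) <= u n + a n).
  { intros n; specialize (hu n); specialize (hstep n).
    apply Rabs_le_between in hu; lra. }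
  assert (ha0 : forall n, 0 <= a n).
  { intros n; unfold a; generalize (hu 0%nat) (Rabs_pos (u 1%nat - u 0%nat)).
    simpl; intros h1 h2; apply Rmult_le_pos; [|apply pow_le; lra].
    apply Rle_div_r; lra. }
  assert (hub : forall n, u n + a n <= u 0%nat + a 0%nat).
  { induction n; [lra|]; specialize (hdecr n); lra. }
  destruct (ex_finite_lim_seq_incr (fun n => u n - a n) (u 0%nat + a 0%nat))
    as [l hl]; [exact hincr| |].
  { intros n; specialize (hub n); specialize (ha0 n); lra. }
  assert (hul : is_lim_seq u l).
  { apply is_lim_seq_ext with (fun n => (u n - a n) + a n); [intros; ring|].
    replace (Finite l) with (Finite (l + 0)) by (f_equal; ring).
    apply is_lim_seq_plus'; assumption. }
  rewrite (is_lim_seq_unique _ _ hul); simpl.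
  assert (hul' : is_lim_seq (fun n => u n + a n) l).
  { replace (Finite l) with (Finite (l + 0)) by (f_equal; ring).
    apply is_lim_seq_plus'; assumption. }
  intros n.
  (* Both monotone sequences tend to [l], which therefore lies between [u n - a n] and
     [u n + a n]. *)
  generalize (is_lim_seq_incr_compare _ _ hl hincr n)
    (is_lim_seq_decr_compare _ _ hul' hdecr n); simpl; intros h1 h2.
  apply Rabs_le_between; fold (a n); lra.
Qed.

Lemma Rabs_le_geometric_eq0 (x K q : R) :
  0 <= q < 1 -> (forall n, Rabs x <= K * q ^ n) -> x = 0.
Proof.
  intros hq hx.
  assert (h : Rbar_le (Rabs x) 0).
  { apply (is_lim_seq_le (fun _ => Rabs x) (fun n => K * q ^ n)); auto.
    - apply is_lim_seq_const.
    - apply is_lim_seq_scal_geom; exact hq. }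
  simpl in h; generalize (Rabs_pos x); intros h0.
  destruct (Req_dec x 0) as [|hn]; [assumption|].
  apply Rabs_no_R0 in hn; lra.
Qed.

(** * The weighted contraction estimate and uniqueness *)

Lemma RInt_lipschitz_contract (f : R -> R -> R) (a t L eta K : R) (u v : R -> R) :
  a <= t -> 0 < L -> 0 < eta ->
  (forall s x1 x2, a <= s <= t -> Rabs (f s x1 - f s x2) <= L * Rabs (x1 - x2)) ->
  ex_RInt (fun s => f s (u s)) a t -> ex_RInt (fun s => f s (v s)) a t ->
  (forall s, a <= s <= t -> Rabs (u s - v s) <= K * exp (eta * (s - a))) ->
  Rabs (RInt (fun s => f s (u s)) a t - RInt (fun s => f s (v s)) a t)
    <= K * (L / eta) * exp (eta * (t - a)).
Proof.
  intros hat hL heta hLip hu hv huv.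
  (* At [s = a] the weight is 1, so [K] dominates an absolute value. *)
  assert (hK : 0 <= K).
  { generalize (huv a (conj (Rle_refl a) hat)) (Rabs_pos (u a - v a)).
    rewrite Rminus_diag, Rmult_0_r, exp_0; lra. }
  (* An antiderivative of the Lipschitz majorant: integrating the weight gains a factor [/ eta],
     which turns [L] into the ratio [L / eta]. *)
  set (G := fun s => K * (L / eta) * exp (eta * (s - a))).
  assert (hG : is_RInt (fun s => L * (K * exp (eta * (s - a)))) a t (minus (G t) (G a))).
  { apply (is_RInt_derive (V := R_CompleteNormedModule)).
    - intros s _; unfold G; auto_derive; [trivial|unfold Rminus; field; lra].
    - intros s _; apply (ex_derive_continuous (V := R_NormedModule)).
      auto_derive; trivial. }
  assert (h := norm_RInt_le (V := R_NormedModule) _ _ a t _ _ hat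
    (fun s hs => Rle_trans _ _ _ (hLip s (u s) (v s) hs)
                   (Rmult_le_compat_l _ _ _ (Rlt_le _ _ hL) (huv s hs)))
    (is_RInt_minus (V := R_NormedModule) _ _ _ _ _ _
       (RInt_correct (V := R_CompleteNormedModule) _ _ _ hu)
       (RInt_correct (V := R_CompleteNormedModule) _ _ _ hv)) hG).
  (* The integral of the majorant is [G t - G a]; dropping [G a] leaves the claimed bound. *)
  assert (hGa : 0 <= G a).
  { unfold G; apply Rmult_le_pos; [|left; apply exp_pos].
    apply Rmult_le_pos; [exact hK|left; apply Rdiv_lt_0_compat; lra]. }
  unfold norm, minus, plus, opp in h; simpl in h; unfold abs in h; simpl in h.
  fold (G t); unfold Rminus; lra.
Qed.

(** Both functions are fixed points, so applying the contraction estimate to [z] and [w] again and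
    again shrinks the bound on their distance geometrically. *)
Lemma volterra_solution_eq_of_bounded (t0 r : R) (f : R -> R -> R) (L : R) (z w : R -> R)
    (B : R) :
  continuous_on (fun p : R * R => Icc t0 (t0 + r) (fst p))
    (fun p : R * R => f (fst p) (snd p)) ->
  0 < L ->
  (forall t y1 y2, Icc t0 (t0 + r) t -> Rabs (f t y1 - f t y2) <= L * Rabs (y1 - y2)) ->
  volterra_solution t0 r f z -> volterra_solution t0 r f w ->
  (forall t, Icc t0 (t0 + r) t -> Rabs (z t - w t) <= B) ->
  forall t, Icc t0 (t0 + r) t -> z t = w t.
Proof.
  intros hf hL hLip [hz ez] [hw ew] hB.
  (* Any exponent above [L] would do; this one makes the ratio one half. *)
  set (eta := 2 * L).
  assert (hq : L / eta = / 2) by (unfold eta; field; lra).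
  assert (hn : forall n t, Icc t0 (t0 + r) t ->
                 Rabs (z t - w t) <= B * (/ 2) ^ n * exp (eta * (t - t0))).
  { induction n as [|n IH]; intros t ht.
    - simpl; rewrite Rmult_1_r.
      assert (h0 := hB t ht).
      assert (h1 := Rabs_pos (z t - w t)).
      assert (h2 : 1 <= exp (eta * (t - t0))).
      { rewrite <- exp_0; apply exp_monotone, Rmult_le_pos; destruct ht; unfold eta; lra. }
      nra.
    - rewrite (ez t ht), (ew t ht).
      replace (B * (/ 2) ^ S n) with (B * (/ 2) ^ n * (L / eta))
        by (rewrite hq; simpl; ring).
      destruct ht as [ht1 ht2].
      apply RInt_lipschitz_contract; unfold eta in *; try lra.
      + intros s x1 x2 hs; apply hLip; unfold Icc; lra.
      + apply ex_RInt_continuous_on with (t0 + r); [|split; assumption].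
        apply continuous_on_curve; assumption.
      + apply ex_RInt_continuous_on with (t0 + r); [|split; assumption].
        apply continuous_on_curve; assumption.
      + intros s hs; apply IH; unfold Icc; lra. }
  intros t ht.
  apply Rminus_diag_uniq, (Rabs_le_geometric_eq0 _ (B * exp (eta * (t - t0))) (/ 2)).
  - lra.
  - intros n; generalize (hn n t ht); lra.
Qed.

(** * Picard iteration from the approximate solution *)

Theorem theorem2p4 (t0 r : R) (hr : 0 < r)
  (f : R -> R -> R)
  (hf : continuous_on (fun p : R * R => Icc t0 (t0 + r) (fst p))
          (fun p : R * R => f (fst p) (snd p)))
  (L : R) (hL : 0 < L)
  (hLip : forall t y1 y2 : R, Icc t0 (t0 + r) t ->
            Rabs (f t y1 - f t y2) <= L * Rabs (y1 - y2))
  (phi : R -> R)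
  (hphi_pos : forall t : R, Icc t0 (t0 + r) t -> 0 < phi t)
  (hphi_mono : forall s t : R, Icc t0 (t0 + r) s -> Icc t0 (t0 + r) t ->
                 s <= t -> phi s <= phi t)
  (hphi_cont : continuous_on (Icc t0 (t0 + r)) phi)
  (eta : R) (heta : L < eta)
  (y : R -> R)
  (hy_cont : continuous_on (Icc t0 (t0 + r)) y)
  (hy : forall t : R, Icc t0 (t0 + r) t ->
          Rabs (y t - RInt (fun s => f s (y s)) t0 t) <= phi t) :
  exists y0 : R -> R,
    (volterra_solution t0 r f y0 /\
     forall t : R, Icc t0 (t0 + r) t ->
       Rabs (y t - y0 t) <= phi t * exp (eta * r) / (1 - L / eta)) /\
    (forall z : R -> R,
       volterra_solution t0 r f z ->
       (forall t : R, Icc t0 (t0 + r) t ->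
          Rabs (y t - z t) <= phi t * exp (eta * r) / (1 - L / eta)) ->
       forall t : R, Icc t0 (t0 + r) t -> z t = y0 t).
Proof.
  set (q := L / eta).
  assert (hq : 0 <= q < 1).
  { split; [left; apply Rdiv_lt_0_compat; lra|].
    unfold q; apply Rlt_div_l; lra. }
  set (T := fun (u : R -> R) t => RInt (fun s => f s (u s)) t0 t).
  assert (hT : forall u, continuous_on (Icc t0 (t0 + r)) u ->
                 continuous_on (Icc t0 (t0 + r)) (T u)).
  { intros u hu; apply continuous_on_RInt, continuous_on_curve; assumption. }
  (* The hypothesis only concerns [s] up to [t], so [K] may depend on [t]; below it is
     [phi t * q ^ n]. *)
  assert (hcontract : forall K t u v, Icc t0 (t0 + r) t ->
    continuous_on (Icc t0 (t0 + r)) u -> continuous_on (Icc t0 (t0 + r)) v ->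
    (forall s, t0 <= s <= t -> Rabs (u s - v s) <= K * exp (eta * (s - t0))) ->
    Rabs (T u t - T v t) <= K * q * exp (eta * (t - t0))).
  { intros K t u v [ht1 ht2] hu hv huv.
    apply RInt_lipschitz_contract; try lra.
    - intros s x1 x2 hs; apply hLip; unfold Icc; lra.
    - apply ex_RInt_continuous_on with (t0 + r); [|split; assumption].
      apply continuous_on_curve; assumption.
    - apply ex_RInt_continuous_on with (t0 + r); [|split; assumption].
      apply continuous_on_curve; assumption.
    - exact huv. }
  set (u := fun n => Nat.iter n T y).
  assert (hu : forall n, continuous_on (Icc t0 (t0 + r)) (u n)).
  { induction n; [exact hy_cont|apply hT; exact IHn]. }
  assert (hstep : forall n t, Icc t0 (t0 + r) t ->
    Rabs (u (S n) t - u n t) <= phi t * q ^ n * exp (eta * (t - t0))).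
  { induction n as [|n IH]; intros t ht.
    - simpl; rewrite Rmult_1_r, Rabs_minus_sym.
      apply Rle_trans with (1 := hy t ht).
      assert (1 <= exp (eta * (t - t0))).
      { rewrite <- exp_0; apply exp_monotone, Rmult_le_pos; destruct ht; lra. }
      generalize (hphi_pos t ht); nra.
    - replace (phi t * q ^ S n) with (phi t * q ^ n * q) by (simpl; ring).
      apply (hcontract _ t (u (S n)) (u n) ht (hu (S n)) (hu n)).
      intros s hs.
      assert (hs' : Icc t0 (t0 + r) s) by (destruct ht; unfold Icc; lra).
      apply Rle_trans with (1 := IH s hs').
      apply Rmult_le_compat_r; [left; apply exp_pos|].
      apply Rmult_le_compat_r; [apply pow_le; lra|].
      apply hphi_mono; [assumption|assumption|lra]. }
  (* [Lim_seq] and [real] are total; on the interval the geometric bound makes this a genuine finite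
     limit, and values elsewhere are irrelevant. *)
  set (y0 := fun t => real (Lim_seq (fun n => u n t))).
  assert (hy0 : forall n t, Icc t0 (t0 + r) t ->
    Rabs (u n t - y0 t) <= phi t * exp (eta * (t - t0)) / (1 - q) * q ^ n).
  { intros n t ht; apply (geometric_cauchy_bound (fun n => u n t)); [exact hq|].
    intros m; generalize (hstep m t ht); lra. }
  assert (hexp : forall t, Icc t0 (t0 + r) t ->
    phi t * exp (eta * (t - t0)) / (1 - q) <= phi t * exp (eta * r) / (1 - q)).
  { intros t ht; unfold Rdiv.
    apply Rmult_le_compat_r; [left; apply Rinv_0_lt_compat; lra|].
    apply Rmult_le_compat_l; [left; apply hphi_pos; exact ht|].
    apply exp_monotone, Rmult_le_compat_l; destruct ht; lra. }
  (* The pointwise bound at the right endpoint, where [phi] is largest: it makes the convergence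
     uniform, hence [y0] continuous. *)
  set (M := phi (t0 + r) * exp (eta * r) / (1 - q)).
  assert (hM : forall t, Icc t0 (t0 + r) t -> phi t * exp (eta * r) / (1 - q) <= M).
  { intros t ht; unfold M, Rdiv.
    apply Rmult_le_compat_r; [left; apply Rinv_0_lt_compat; lra|].
    apply Rmult_le_compat_r; [left; apply exp_pos|].
    apply hphi_mono; [exact ht|unfold Icc; lra|apply ht]. }
  assert (hunif : forall n t, Icc t0 (t0 + r) t -> Rabs (u n t - y0 t) <= M * q ^ n).
  { intros n t ht; apply Rle_trans with (1 := hy0 n t ht).
    apply Rmult_le_compat_r; [apply pow_le; lra|].
    apply Rle_trans with (1 := hexp t ht), hM, ht. }
  assert (hy0_cont : continuous_on (Icc t0 (t0 + r)) y0).
  { apply (continuous_on_uniform_limit _ u y0 (fun n => M * q ^ n)); auto.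
    apply is_lim_seq_scal_geom; exact hq. }
  assert (hbound : forall t, Icc t0 (t0 + r) t ->
    Rabs (y t - y0 t) <= phi t * exp (eta * r) / (1 - q)).
  (* The case [n = 0], since [u 0] is [y]. *)
  { intros t ht; generalize (hy0 0%nat t ht) (hexp t ht); simpl; lra. }
  assert (hsol : volterra_solution t0 r f y0).
  { split; [exact hy0_cont|]; intros t ht; change (y0 t = T y0 t).
    (* [u (S n) = T (u n)] is close to both [y0] and [T y0]; the constant adds the two errors, each
       carrying a factor [q ^ S n]. *)
    apply Rminus_diag_uniq,
      (Rabs_le_geometric_eq0 _ (M * q + M * q * exp (eta * (t - t0))) q hq).
    intros n.
    assert (h1 := hunif (S n) t ht).
    assert (h2 : Rabs (u (S n) t - T y0 t) <= M * q ^ n * q * exp (eta * (t - t0))).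
    { apply (hcontract _ t (u n) y0 ht (hu n) hy0_cont).
      intros s hs.
      assert (hs' : Icc t0 (t0 + r) s) by (destruct ht; unfold Icc; lra).
      assert (h3 := hunif n s hs').
      assert (h4 := Rabs_pos (u n s - y0 s)).
      (* The uniform bound is nonnegative by [h3] and [h4], so multiplying it by a weight of at
         least 1 only weakens it. *)
      assert (1 <= exp (eta * (s - t0))).
      { rewrite <- exp_0; apply exp_monotone, Rmult_le_pos; lra. }
      nra. }
    replace (y0 t - T y0 t) with ((u (S n) t - T y0 t) - (u (S n) t - y0 t)) by ring.
    apply Rle_trans with (1 := Rabs_triang _ _); rewrite Rabs_Ropp.
    simpl pow in h1; lra. }
  exists y0; split; [split; assumption|].
  intros z hz hzb.
  (* Both solutions lie within [M] of [y], hence within [2 * M] of each other. *)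
  apply (volterra_solution_eq_of_bounded t0 r f L z y0 (2 * M)); try assumption.
  intros t ht.
  generalize (hzb t ht) (hbound t ht) (hM t ht); fold q; intros h1 h2 h3.
  apply Rabs_le_between in h1; apply Rabs_le_between in h2.
  apply Rabs_le_between; lra.
Qed.
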